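(* Let $A_1, A_2$ be real symmetric $n\times n$ matrices and let $0<\alpha_1<\alpha_2<+\infty$. If $n\ge 3$, then the set $$\mathcal{W}_3=\left\{(x^TA_1x,\;x^TA_2x):\ \alpha_1\le x^Tx\le \alpha_2,\ x\in\mathbb{R}^n\right\}\subset\mathbb{R}^2$$ is convex and compact. *)

(* Defs.v *)
From mathcomp Require Import all_boot all_order all_algebra.
From mathcomp Require Import all_classical all_reals all_analysis.

Set Implicit Arguments.
Unset Strict Implicit.
Unset Printing Implicit Defensive.

Import Order.TTheory GRing.Theory Num.Theory.
Import numFieldNormedType.Exports.
Local Open Scope classical_set_scope.
Local Open Scope ring_scope.

Definition qform (R : realType) (n : nat) (A : 'M[R]_n) (x : 'cV[R]_n) : R :=
  (x^T *m A *m x) 0 0.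

Definition sqnorm (R : realType) (n : nat) (x : 'cV[R]_n) : R :=
  (x^T *m x) 0 0.

(* The plane is R^o * R^o: the product carries both the R-module structure
   required by convex_set and the product topology used by compact. *)
Definition W3 (R : realType) (n : nat) (A1 A2 : 'M[R]_n) (a1 a2 : R)
    : set (R^o * R^o) :=
  [set (qform A1 x, qform A2 x)
    | x in [set x : 'cV[R]_n | a1 <= sqnorm x <= a2]].

(* Main.v *)
(** Let (P1, P2, N) be a convex combination of the values of (A1, A2, |.|^2) at
    x and y.  A vector of squared norm N with values (P1, P2) is obtained by
    scaling any common nonzero zero of the forms N A_i - P_i I, and the values
    of this pair of forms at x and y lie on opposite rays from the origin.  So
    it suffices to show, for n >= 3, that two quadratic forms g, h with
    g(x) = g(y) = 0 and h(x) <= 0 <= h(y), x and y nonzero, have a common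
    nonzero zero.  As n >= 3, some nonzero w is g-orthogonal to x and y.  Up to
    replacing y by -y, a suitably scaled w makes the parabolic arc
    (1-t)^2 x + t(1-t) w + t^2 y stay on the cone g = 0, and h vanishes
    somewhere on it by the intermediate value theorem.  If w is isotropic, one
    goes from x to y through w along totally isotropic planes instead. *)
Require Import Defs.
From mathcomp Require Import all_boot all_order all_algebra.
From mathcomp Require Import all_classical all_reals all_analysis.
From mathcomp Require Import ring lra.

Set Implicit Arguments.
Unset Strict Implicit.
Unset Printing Implicit Defensive.

Import Order.TTheory GRing.Theory Num.Theory.
Import numFieldNormedType.Exports.
Local Open Scope classical_set_scope.
Local Open Scope ring_scope.

(** * Algebra of bilinear and quadratic forms *)

Definition bform (R : realType) (n : nat) (A : 'M[R]_n) (x y : 'cV[R]_n) : R :=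
  (x^T *m A *m y) 0 0.

Lemma bformDl (R : realType) (n : nat) (A : 'M[R]_n) (x y z : 'cV[R]_n) :
  bform A (x + y) z = bform A x z + bform A y z.
Proof. by rewrite /bform linearD /= !mulmxDl mxE. Qed.

Lemma bformDr (R : realType) (n : nat) (A : 'M[R]_n) (x y z : 'cV[R]_n) :
  bform A z (x + y) = bform A z x + bform A z y.
Proof. by rewrite /bform mulmxDr mxE. Qed.

Lemma bformZl (R : realType) (n : nat) (A : 'M[R]_n) (k : R) (x y : 'cV[R]_n) :
  bform A (k *: x) y = k * bform A x y.
Proof. by rewrite /bform linearZ /= -!scalemxAl mxE. Qed.

Lemma bformZr (R : realType) (n : nat) (A : 'M[R]_n) (k : R) (x y : 'cV[R]_n) :
  bform A x (k *: y) = k * bform A x y.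
Proof. by rewrite /bform -scalemxAr mxE. Qed.

Lemma bformC (R : realType) (n : nat) (A : 'M[R]_n) (x y : 'cV[R]_n) :
  A^T = A -> bform A x y = bform A y x.
Proof.
move=> symA; rewrite /bform.
have -> : x^T *m A *m y = (y^T *m A *m x)^T.
  by rewrite !trmx_mul trmxK symA mulmxA.
by rewrite mxE.
Qed.

Lemma qform_comb3 (R : realType) (n : nat) (A : 'M[R]_n) (a b c : R)
    (x w y : 'cV[R]_n) : A^T = A ->
  qform A (a *: x + b *: w + c *: y) =
    a ^+ 2 * qform A x + b ^+ 2 * qform A w + c ^+ 2 * qform A y +
    2 * (a * b * bform A x w + a * c * bform A x y + b * c * bform A w y).
Proof.
(* [qform A x] is convertible to [bform A x x], so it expands by bilinearity. *)
move=> symA; rewrite -[LHS]/(bform _ _ _) -3![qform _ _]/(bform _ _ _).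
rewrite !(bformDl, bformDr, bformZl, bformZr).
rewrite (bformC w x)// (bformC y x)// (bformC y w)//.
by ring.
Qed.

Lemma qformZ (R : realType) (n : nat) (A : 'M[R]_n) (k : R) (x : 'cV[R]_n) :
  qform A (k *: x) = k ^+ 2 * qform A x.
Proof. by rewrite -[LHS]/(bform _ _ _) bformZl bformZr mulrA expr2. Qed.

Lemma qformDm (R : realType) (n : nat) (A B : 'M[R]_n) (x : 'cV[R]_n) :
  qform (A + B) x = qform A x + qform B x.
Proof. by rewrite /qform mulmxDr mulmxDl mxE. Qed.

Lemma qformZm (R : realType) (n : nat) (A : 'M[R]_n) (k : R) (x : 'cV[R]_n) :
  qform (k *: A) x = k * qform A x.
Proof. by rewrite /qform -scalemxAr -scalemxAl mxE. Qed.

Lemma qform1 (R : realType) (n : nat) (x : 'cV[R]_n) : qform 1%:M x = sqnorm x.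
Proof. by rewrite /qform /sqnorm mulmx1. Qed.

Lemma sqnormE (R : realType) (n : nat) (x : 'cV[R]_n) :
  sqnorm x = \sum_i x i 0 ^+ 2.
Proof. by rewrite /sqnorm mxE; apply: eq_bigr => i _; rewrite mxE. Qed.

Lemma sqnormZ (R : realType) (n : nat) (k : R) (x : 'cV[R]_n) :
  sqnorm (k *: x) = k ^+ 2 * sqnorm x.
Proof. by rewrite -!qform1 qformZ. Qed.

Lemma sqnorm_gt0 (R : realType) (n : nat) (x : 'cV[R]_n) :
  (0 < sqnorm x) = (x != 0).
Proof.
rewrite sqnormE lt0r sumr_ge0 ?andbT; last by move=> i _; exact: sqr_ge0.
congr negb; rewrite psumr_eq0; last by move=> i _; exact: sqr_ge0.
apply/allP/eqP => [x0|-> i _]; last by rewrite /= mxE expr0n.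
apply/matrixP => i j; rewrite ord1 mxE.
by apply/eqP; rewrite -sqrf_eq0; apply: x0; rewrite mem_index_enum.
Qed.

(** * Common isotropic vectors of two forms *)

Definition arc (R : realType) (n : nat) (x w y : 'cV[R]_n) (t : R) : 'cV[R]_n :=
  (1 - t) ^+ 2 *: x + (t * (1 - t)) *: w + t ^+ 2 *: y.

(** Along the arc, [H] is a polynomial in [t] running from [qform H x] at 0 to [qform H y] at 1. *)
Lemma arc_ivt (R : realType) (n : nat) (H : 'M[R]_n) (x w y : 'cV[R]_n) :
  H^T = H -> qform H x <= 0 <= qform H y ->
  exists t, qform H (arc x w y t) = 0.
Proof.
move=> symH Hxy.
pose a : {poly R} := (1 - 'X) ^+ 2.
pose b : {poly R} := 'X * (1 - 'X).
pose c : {poly R} := 'X ^+ 2.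
pose p : {poly R} :=
  a ^+ 2 * (qform H x)%:P + b ^+ 2 * (qform H w)%:P + c ^+ 2 * (qform H y)%:P +
  2%:P * (a * b * (bform H x w)%:P + a * c * (bform H x y)%:P
    + b * c * (bform H w y)%:P).
have pE t : p.[t] = qform H (arc x w y t).
  by rewrite /arc qform_comb3// /p /a /b /c !hornerE.
have [|t _ /rootP] := @poly_ivt R p 0 1 ler01; last by rewrite pE; exists t.
rewrite !pE /arc subr0 subrr mul0r mulr0 !expr0n !expr1n /=.
by rewrite !scale0r !scale1r !addr0 add0r.
Qed.

(** [G] vanishes on the whole span of [x] and [y], so the arc with [w = 0] stays isotropic; only its
    passing through the origin needs care. *)
Lemma isotropic_plane_zero (R : realType) (n : nat) (G H : 'M[R]_n)
    (x y : 'cV[R]_n) :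
  G^T = G -> H^T = H -> x != 0 -> y != 0 ->
  qform G x = 0 -> qform G y = 0 -> bform G x y = 0 ->
  qform H x <= 0 <= qform H y ->
  exists z, [/\ z != 0, qform G z = 0 & qform H z = 0].
Proof.
move=> symG symH x0 y0 Gx Gy Gxy Hxy.
have [t Ht] := arc_ivt 0 symH Hxy.
have [z0|z0] := eqVneq (arc x 0 y t) 0; last first.
  exists (arc x 0 y t); split=> //; rewrite qform_comb3// Gx Gy Gxy.
  have -> : (0 : 'cV[R]_n) = 0 *: x by rewrite scale0r.
  by rewrite qformZ bformZr bformZl Gx Gxy -[bform G x x]/(qform G x) Gx; ring.
(* The arc meets the origin only if x and y are proportional. *)
exists y; split=> //.
have t0 : t != 0.
  apply: contra_neq x0 => t0; move: z0.
  by rewrite /arc t0 subr0 expr0n/= !scaler0 scale0r !addr0 expr1n scale1r.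
have /eqP : t ^+ 2 *: y = - ((1 - t) ^+ 2 *: x).
  by apply/eqP; rewrite -addr_eq0 addrC; move: z0; rewrite /arc scaler0 addr0 => ->.
(* Applying [H] gives [t^4 H(y) = (1-t)^4 H(x) <= 0]; as [H(y) >= 0] and [t] is nonzero,
   [H(y) = 0]. *)
rewrite -scaleNr => /eqP/(congr1 (qform H)); rewrite !qformZ => e.
case/andP: Hxy => Hx Hy; apply/eqP; rewrite eq_le Hy andbT.
have : 0 < (t ^+ 2) ^+ 2 by rewrite exprn_even_gt0// expf_neq0.
move=> /ler_pM2l <-; rewrite mulr0 e.
by apply: mulr_ge0_le0 => //; exact: sqr_ge0.
Qed.

(** The matrix with columns [G x] and [G y] has rank at most 2, less than [n], so its left kernel is
    nonzero. This is where the dimension bound enters. *)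
Lemma exists_orthogonal2 (R : realType) (n : nat) (G : 'M[R]_n)
    (x y : 'cV[R]_n) : (3 <= n)%N ->
  exists w, [/\ w != 0, bform G w x = 0 & bform G w y = 0].
Proof.
move=> n3; pose M := row_mx (G *m x) (G *m y).
have K0 : kermx M != 0.
  rewrite -mxrank_eq0 mxrank_ker -lt0n subn_gt0.
  exact: leq_ltn_trans (rank_leq_col _) n3.
exists (nz_row (kermx M))^T; split.
- by rewrite trmx_eq0 nz_row_eq0.
- have /sub_kermxP := nz_row_sub (kermx M); rewrite mul_mx_row -row_mx0.
  by case/eq_row_mx => /[!mulmxA] e _; rewrite /bform trmxK e mxE.
- have /sub_kermxP := nz_row_sub (kermx M); rewrite mul_mx_row -row_mx0.
  by case/eq_row_mx => _ /[!mulmxA] e; rewrite /bform trmxK e mxE.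
Qed.

(** The square of the weight of [w] on the arc is the product of the weights of [x] and [y], so
    there [G] equals [t^2 (1-t)^2 (G(w) + 2 G(x,y))]. The sign hypothesis allows [w] to be rescaled
    so that the last factor is zero. *)
Lemma nondegenerate_arc_zero (R : realType) (n : nat) (G H : 'M[R]_n)
    (x w y : 'cV[R]_n) :
  G^T = G -> H^T = H -> qform G x = 0 -> qform G y = 0 ->
  bform G w x = 0 -> bform G w y = 0 ->
  bform G x y * qform G w < 0 -> qform H x <= 0 <= qform H y ->
  exists z, [/\ z != 0, qform G z = 0 & qform H z = 0].
Proof.
move=> symG symH Gx Gy Gwx Gwy bc Hxy.
have c0 : qform G w != 0 by apply: contraTneq bc => ->; rewrite mulr0 ltxx.
have b0 : bform G x y != 0 by apply: contraTneq bc => ->; rewrite mul0r ltxx.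
pose k := - (2 * bform G x y) / qform G w.
have k0 : 0 <= k.
  have -> : k = - (2 * (bform G x y * qform G w)) / qform G w ^+ 2.
    by rewrite /k; field.
  by rewrite divr_ge0 ?sqr_ge0//; lra.
pose v := Num.sqrt k *: w.
have Gv : qform G v = - (2 * bform G x y).
  by rewrite qformZ sqr_sqrtr// /k divfK.
have Gvx : bform G v x = 0 by rewrite bformZl Gwx mulr0.
have Gvy : bform G v y = 0 by rewrite bformZl Gwy mulr0.
clearbody v.
have [t Ht] := arc_ivt v symH Hxy.
exists (arc x v y t); split=> //; last first.
  by rewrite qform_comb3// Gx Gy Gv (bformC x v)// Gvx Gvy; ring.
(* Pairing the arc with [x] and [y] gives [t^2 G(x,y)] and [(1-t)^2 G(x,y)], which cannot both
   vanish. *)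
apply/eqP => z0.
have : bform G (arc x v y t) y = 0 by rewrite z0 -(scale0r x) bformZl mul0r.
have : bform G (arc x v y t) x = 0 by rewrite z0 -(scale0r x) bformZl mul0r.
rewrite /arc !bformDl !bformZl Gvx Gvy (bformC y x)//.
rewrite -[bform G x x]/(qform G x) -[bform G y y]/(qform G y) Gx Gy.
rewrite !(mulr0, add0r, addr0) => /eqP; rewrite mulf_eq0 (negPf b0) orbF.
rewrite sqrf_eq0 => /eqP -> /eqP.
by rewrite subr0 expr1n mul1r (negPf b0).
Qed.

Lemma isotropic_common_zero (R : realType) (n : nat) (G H : 'M[R]_n)
    (x y : 'cV[R]_n) : (3 <= n)%N ->
  G^T = G -> H^T = H -> x != 0 -> y != 0 ->
  qform G x = 0 -> qform G y = 0 -> qform H x <= 0 <= qform H y ->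
  exists z, [/\ z != 0, qform G z = 0 & qform H z = 0].
Proof.
move=> n3 symG symH x0 y0 Gx Gy Hxy; have /andP[Hx Hy] := Hxy.
have [w [w0 Gwx Gwy]] := exists_orthogonal2 G x y n3.
have [Gxy|b0] := eqVneq (bform G x y) 0.
  exact: (@isotropic_plane_zero _ _ G H x y).
have [Gw|c0] := eqVneq (qform G w) 0.
  (* Both planes [x, w] and [w, y] are totally isotropic; the sign of [H(w)] tells on which of them
     [H] changes sign. *)
  have [Hw|/ltW Hw] := leP 0 (qform H w).
  - apply: (@isotropic_plane_zero _ _ G H x w) => //; last by rewrite Hx.
    by rewrite bformC.
  - by apply: (@isotropic_plane_zero _ _ G H w y) => //; rewrite Hw.
have : bform G x y * qform G w != 0 by rewrite mulf_neq0.
rewrite neq_lt => /orP[bc|bc].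
  exact: (@nondegenerate_arc_zero _ _ G H x w y).
(* Replacing [y] by its opposite flips the sign of [G(x,y)] and keeps all quadratic values. *)
have qN A : qform A (- 1 *: y) = qform A y by rewrite qformZ; ring.
apply: (@nondegenerate_arc_zero _ _ G H x w (- 1 *: y)); rewrite ?qN//.
  by rewrite bformZr Gwy mulr0.
by rewrite bformZr mulN1r mulNr oppr_lt0.
Qed.

(** Carrying the squared norm as a third coordinate is what keeps [z] inside the shell. *)
Lemma qform_convex_comb (R : realType) (n : nat) (A1 A2 : 'M[R]_n)
    (x y : 'cV[R]_n) (l : R) : (3 <= n)%N ->
  A1^T = A1 -> A2^T = A2 -> x != 0 -> y != 0 -> 0 < l < 1 ->
  exists z, [/\ sqnorm z = l * sqnorm x + (1 - l) * sqnorm y,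
    qform A1 z = l * qform A1 x + (1 - l) * qform A1 y &
    qform A2 z = l * qform A2 x + (1 - l) * qform A2 y].
Proof.
move=> n3 symA1 symA2 x0 y0 /andP[l0 l1].
set N := l * sqnorm x + _; set P1 := l * qform A1 x + _.
set P2 := l * qform A2 x + _.
have sx : 0 < sqnorm x by rewrite sqnorm_gt0.
have sy : 0 < sqnorm y by rewrite sqnorm_gt0.
have N0 : 0 < N by rewrite addr_gt0// mulr_gt0// subr_gt0.
(* These equations are homogeneous in [z], so the norm can be adjusted afterwards. *)
suff [z [z0 z1 z2]] : exists z, [/\ z != 0,
    N * qform A1 z = P1 * sqnorm z & N * qform A2 z = P2 * sqnorm z].
  have sz : 0 < sqnorm z by rewrite sqnorm_gt0.
  have k0 : 0 <= N / sqnorm z by rewrite divr_ge0// ltW.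
  exists (Num.sqrt (N / sqnorm z) *: z).
  rewrite sqnormZ !qformZ sqr_sqrtr//.
  split; first by rewrite divfK// gt_eqF.
  - by rewrite mulrAC z1 mulfK// gt_eqF.
  - by rewrite mulrAC z2 mulfK// gt_eqF.
pose B1 := N *: A1 - P1 *: 1%:M; pose B2 := N *: A2 - P2 *: 1%:M.
have symB1 : B1^T = B1 by rewrite /B1 linearB !linearZ /= symA1 trmx1.
have symB2 : B2^T = B2 by rewrite /B2 linearB !linearZ /= symA2 trmx1.
have B1E z : qform B1 z = N * qform A1 z - P1 * sqnorm z.
  by rewrite /B1 -scaleNr qformDm !qformZm qform1 mulNr.
have B2E z : qform B2 z = N * qform A2 z - P2 * sqnorm z.
  by rewrite /B2 -scaleNr qformDm !qformZm qform1 mulNr.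
suff [z [z0 z1 z2]] : exists z, [/\ z != 0, qform B1 z = 0 & qform B2 z = 0].
  exists z; split=> //; apply/eqP; rewrite -subr_eq0.
  - by rewrite -B1E z1.
  - by rewrite -B2E z2.
(* [N] and [P1] are averages with the same weights, so the two products cancel. *)
have c1 : l * qform B1 x + (1 - l) * qform B1 y = 0.
  by rewrite !B1E /P1 /N; ring.
have c2 : l * qform B2 x + (1 - l) * qform B2 y = 0.
  by rewrite !B2E /P2 /N; ring.
move: c1 c2; set u1 := qform B1 x; set u2 := qform B2 x => c1 c2.
have l1' : 1 - l != 0 by rewrite gt_eqF// subr_gt0.
have v1 : qform B1 y = - (l / (1 - l)) * u1.
  apply: (mulfI l1'); rewrite -[LHS](addKr (l * u1)) c1; field.
  by [].
have v2 : qform B2 y = - (l / (1 - l)) * u2.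
  apply: (mulfI l1'); rewrite -[LHS](addKr (l * u2)) c2; field.
  by [].
have k0 : 0 < l / (1 - l) by rewrite divr_gt0// subr_gt0.
pose m := u1 ^+ 2 + u2 ^+ 2.
have [m0|m0] := eqVneq m 0.
  exists x; split=> //; apply/eqP; rewrite -sqrf_eq0;
    by move/eqP: m0; rewrite paddr_eq0 ?sqr_ge0// => /andP[].
have m_ge0 : 0 <= m by rewrite addr_ge0// sqr_ge0.
(* In the coordinates along and across (u1, u2), the values at x and y lie on
   opposite sides of 0 on one axis. *)
pose G := u2 *: B1 + (- u1) *: B2; pose H := (- u1) *: B1 + (- u2) *: B2.
have GE z : qform G z = u2 * qform B1 z - u1 * qform B2 z.
  by rewrite qformDm !qformZm mulNr.
have HE z : qform H z = - (u1 * qform B1 z + u2 * qform B2 z).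
  by rewrite qformDm !qformZm !mulNr opprD.
have [|||||||z [z0 Gz Hz]] := @isotropic_common_zero _ _ G H x y n3.
- by rewrite /G linearD !linearZ /= symB1 symB2.
- by rewrite /H linearD !linearZ /= symB1 symB2.
- exact: x0.
- exact: y0.
- by rewrite GE -/u1 -/u2; ring.
- by rewrite GE v1 v2; ring.
- rewrite !HE v1 v2 -/u1 -/u2.
  have -> : - (u1 * u1 + u2 * u2) = - m by rewrite /m; ring.
  have -> : - (u1 * (- (l / (1 - l)) * u1) + u2 * (- (l / (1 - l)) * u2)) =
    l / (1 - l) * m by rewrite /m; ring.
  by rewrite oppr_le0 m_ge0/= mulr_ge0// ltW.
(* The change from [B1, B2] to [G, H] has determinant [-m], hence is invertible. *)
exists z; split=> //; apply: (mulfI m0); rewrite mulr0.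
- have -> : m * qform B1 z = u2 * qform G z - u1 * qform H z.
    by rewrite GE HE /m; ring.
  by rewrite Gz Hz; ring.
- have -> : m * qform B2 z = - u1 * qform G z - u2 * qform H z.
    by rewrite GE HE /m; ring.
  by rewrite Gz Hz; ring.
Qed.

(** * Continuity and compactness *)

Lemma continuous_sum (R : realType) (T : topologicalType) (I : Type)
    (s : seq I) (F : I -> T -> R) :
  (forall i, continuous (F i)) -> continuous (fun v => \sum_(i <- s) F i v : R).
Proof.
move=> Fc v; elim: s => [|i s IHs].
  rewrite (_ : (fun u => _) = cst 0); first exact: cst_continuous.
  by apply/funext => u; rewrite big_nil.
rewrite (_ : (fun u => _) = (F i \+ (fun u => \sum_(k <- s) F k u))).
  by apply: cvgD; [exact: Fc|exact: IHs].
by apply/funext => u; rewrite big_cons.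
Qed.

Lemma continuous_qform_trmx (R : realType) (n : nat) (A : 'M[R]_n) :
  continuous (fun v : 'rV[R]_n => qform A v^T : R).
Proof.
have -> : (fun v : 'rV[R]_n => qform A v^T : R) =
    (fun v => \sum_j (\sum_i v 0 i * A i j) * v 0 j : R).
  apply/funext => v; rewrite /qform trmxK mxE; apply: eq_bigr => j _.
  by rewrite !mxE.
have rowC j : continuous (fun v : 'rV[R]_n => \sum_i v 0 i * A i j : R).
  apply: (@continuous_sum R 'rV[R]_n _ _ (fun i v => v 0 i * A i j)) => i v.
  by apply: continuousM; [exact: coord_continuous|exact: cst_continuous].
apply: (@continuous_sum R 'rV[R]_n _ _
  (fun j v => (\sum_i v 0 i * A i j) * v 0 j)) => j v.
by apply: continuousM; [exact: rowC|exact: coord_continuous].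
Qed.

Lemma compact_shell (R : realType) (n : nat) (a b : R) :
  compact [set v : 'rV[R]_n | a <= sqnorm v^T <= b].
Proof.
apply: bounded_closed_compact.
(* The matrix norm is the largest absolute value of an entry, and [r^2 <= b] forces [r <= 1 + b]. *)
- exists (1 + b); split; first exact: num_real.
  move=> M bM v /= /andP[_ vb].
  have b0 : 0 <= b.
    by apply: le_trans vb; rewrite sqnormE sumr_ge0// => i _; exact: sqr_ge0.
  rewrite [leLHS]/Num.norm/= mx_normrE; apply/bigmax_leP; split=> [|[i j] _ /=].
    by lra.
  have : `|v i j| ^+ 2 <= b.
    rewrite real_normK ?num_real//; apply: le_trans vb.
    rewrite sqnormE (bigD1 j)//= mxE (ord1 i) lerDl sumr_ge0// => k _.
    exact: sqr_ge0.
  have := normr_ge0 (v i j); nra.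
- have -> : [set v : 'rV[R]_n | a <= sqnorm v^T <= b] =
      (fun v : 'rV[R]_n => qform 1%:M v^T : R) @^-1` `[a, b].
    by apply/seteqP; split=> v /=; rewrite in_itv/= qform1.
  apply: preimage_closed; last exact: interval_closed.
  by move=> v _; exact: continuous_qform_trmx.
Qed.

Theorem theorem3 (R : realType) (n : nat) (A1 A2 : 'M[R]_n) (a1 a2 : R)
    (symA1 : A1^T = A1) (symA2 : A2^T = A2)
    (a1_gt0 : 0 < a1) (a1_lt_a2 : a1 < a2) (n_ge3 : (3 <= n)%N) :
  convex_set (W3 A1 A2 a1 a2) /\ compact (W3 A1 A2 a1 a2).
Proof.
split.
  (* Only weights strictly between 0 and 1 remain, and [a1 > 0] makes both vectors nonzero. *)
  apply/convex_setW => p q; rewrite !inE => -[x /andP[x1 x2] <-].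
  move=> -[y /andP[y1 y2] <-] k k0 k1; rewrite inE.
  have x0 : x != 0 by rewrite -sqnorm_gt0; exact: lt_le_trans x1.
  have y0 : y != 0 by rewrite -sqnorm_gt0; exact: lt_le_trans y1.
  have [|z [Nz z1 z2]] :=
    @qform_convex_comb _ _ A1 A2 x y k%:num n_ge3 symA1 symA2 x0 y0.
    by rewrite k0 k1.
  exists z; first by rewrite /= Nz; apply/andP; split; nra.
  by rewrite z1 z2.
(* Transposing to row vectors exhibits the set as a continuous image of the compact shell. *)
have -> : W3 A1 A2 a1 a2 =
    (fun v : 'rV[R]_n => (qform A1 v^T, qform A2 v^T) : R^o * R^o) @`
      [set v | a1 <= sqnorm v^T <= a2].
  apply/seteqP; split=> _ [x xa <-]; last by exists x^T.
  by exists x^T => /=; rewrite trmxK.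
apply: continuous_compact; last exact: compact_shell.
apply: continuous_subspaceT => v.
exact: (cvg_pair (@continuous_qform_trmx R n A1 v)
  (@continuous_qform_trmx R n A2 v)).
Qed.
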